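(* Let $(V,g)$ be a Euclidean real vector space of odd dimension $n=2k+1\ge 3$ and let $R$ be a symmetric $(2,2)$ double form on $V$ satisfying the first Bianchi identity. Then $$\Bigl\langle \frac{\mathrm c^{n-3}R^k}{(n-3)!},R\Bigr\rangle-\Bigl\langle \frac{\mathrm c^{n-2}R^k}{(n-2)!},\mathrm cR\Bigr\rangle+\Bigl\langle \frac{\mathrm c^{n-1}R^k}{(n-1)!},\frac{\mathrm c^2R}{2}\Bigr\rangle=0.$$ In particular, for $n=3$, $$\langle R,R\rangle-\langle \mathrm cR,\mathrm cR\rangle+\tfrac14\bigl(\mathrm c^2R\bigr)^2=0.$$
   Context: Let $(V,g)$ be a Euclidean real vector space of dimension $n$. A $(p,q)$ double form is an element of $\mathcal D^{p,q}=\Lambda^pV^*\otimes\Lambda^qV^*$, identified with a bilinear form $\Lambda^pV\times\Lambda^qV\to\mathbb R$. Exterior product: $(\theta_1\otimes\theta_2)(\theta_3\otimes\theta_4)=(\theta_1\wedge\theta_3)\otimes(\theta_2\wedge\theta_4)$, extended bilinearly; $R^k$ is the $k$-th power for this product. Inner product: $\langle\theta_1\otimes\theta_2,\theta_3\otimes\theta_4\rangle=\langle\theta_1,\theta_3\rangle\langle\theta_2,\theta_4\rangle$, using the inner product on $\Lambda^pV^*$ for which $e^{i_1}\wedge\dots\wedge e^{i_p}$, $i_1<\dots<i_p$, are orthonormal when $(e^i)$ is dual to an orthonormal basis (for $(0,0)$ double forms, i.e. scalars, it is the product). Contraction $\mathrm c:\mathcal D^{p,q}\to\mathcal D^{p-1,q-1}$: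 $\mathrm c\,\omega(x_1\wedge\dots\wedge x_{p-1},y_1\wedge\dots\wedge y_{q-1})=\sum_{j=1}^n\omega(e_j\wedge x_1\wedge\dots\wedge x_{p-1},e_j\wedge y_1\wedge\dots\wedge y_{q-1})$ for any orthonormal basis $(e_j)$; $\mathrm c^j$ is the $j$-fold iterate ($\mathrm c^0$ the identity). A $(2,2)$ double form $R$ is symmetric if $R(u,v)=R(v,u)$ for $u,v\in\Lambda^2V$, and satisfies the first Bianchi identity if $\sum_{j=1}^{3}(-1)^jR(x_1\wedge\dots\widehat{x_j}\dots\wedge x_3,\;x_j\wedge y)=0$ for all $x_1,x_2,x_3,y\in V$. *)

(* Defs.v *)
From mathcomp Require Import all_boot all_order all_algebra.
From mathcomp Require Import reals.

Set Implicit Arguments.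
Unset Strict Implicit.
Unset Printing Implicit Defensive.

Import Order.TTheory GRing.Theory Num.Theory.
Local Open Scope ring_scope.

(* Forms of all degrees live in one type, the degree being a support condition
   on the length of the argument list: a p-form on V is a function on lists of
   vectors that vanishes off lists of length p and whose restriction to V^p is
   multilinear and alternating.  Thus alpha [:: x1; ...; xp] is
   alpha(x1 /\ ... /\ xp), and products and contractions of double forms never
   need to transport along equations between degrees. *)
Definition form (K : realType) (V : vectType K) := seq V -> K.

Definition dform (K : realType) (V : vectType K) := seq V -> seq V -> K.

Section DoubleForms.
Variables (K : realType) (V : vectType K).
Implicit Types (alpha beta : form V) (omega eta R : dform V).

Definition is_form (p : nat) alpha : Prop :=
  [/\ forall xs : seq V, size xs != p -> alpha xs = 0,
      forall (s1 s2 : seq V) (a : K) (u v : V),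
        alpha (s1 ++ (a *: u + v) :: s2) =
        a * alpha (s1 ++ u :: s2) + alpha (s1 ++ v :: s2)
    & forall xs : seq V, ~~ uniq xs -> alpha xs = 0].

(* omega belongs to D^{p,q}, seen as the space of bilinear forms on
   Lambda^p V x Lambda^q V. *)
Definition is_dform (p q : nat) omega : Prop :=
  (forall ys : seq V, is_form p (fun xs => omega xs ys)) /\
  (forall xs : seq V, is_form q (omega xs)).

Definition tens alpha beta : dform V := fun xs ys => alpha xs * beta ys.

(* A bit mask s on a list xs encodes the shuffle that lists the selected
   entries of xs first, then the others, each in their original order;
   shuffle_inv s is the number of inversions of that permutation. *)
Fixpoint shuffle_inv (s : bitseq) : nat :=
  if s is b :: s' then ((~~ b) * count id s' + shuffle_inv s')%N else 0%N.

Definition shuffle_sign (s : bitseq) : K := (-1) ^+ shuffle_inv s.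

(* Normalized so that (e^1 /\ ... /\ e^p)(e_1 /\ ... /\ e_p) = 1 for dual
   bases. *)
Definition wedge alpha beta : form V := fun xs =>
  \sum_(s : (size xs).-tuple bool)
     shuffle_sign s * (alpha (mask s xs) * beta (mask (map negb s) xs)).

Definition dmul omega eta : dform V := fun xs ys =>
  \sum_(s : (size xs).-tuple bool) \sum_(t : (size ys).-tuple bool)
     shuffle_sign s * shuffle_sign t *
     (omega (mask s xs) (mask t ys)
      * eta (mask (map negb s) xs) (mask (map negb t) ys)).

Definition dunit : dform V := fun xs ys => (nilp xs && nilp ys)%:R.

Definition dexp omega (k : nat) : dform V := iterop k dmul omega dunit.

Definition dscale (a : K) omega : dform V := fun xs ys => a * omega xs ys.

Definition dcontr (n : nat) (e : n.-tuple V) omega : dform V := fun xs ys =>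
  \sum_(v <- e) omega (v :: xs) (v :: ys).

(* mask s e runs over the families e_{i_1}, ..., e_{i_p}, i_1 < ... < i_p, so
   this makes the e^I (x) e^J orthonormal when e is an orthonormal basis;
   components of distinct degrees are orthogonal. *)
Definition dinner (n : nat) (e : n.-tuple V) omega eta : K :=
  \sum_(s : n.-tuple bool) \sum_(t : n.-tuple bool)
     omega (mask s e) (mask t e) * eta (mask s e) (mask t e).

Definition finner (n : nat) (e : n.-tuple V) alpha beta : K :=
  \sum_(s : n.-tuple bool) alpha (mask s e) * beta (mask s e).

Definition dsymmetric R : Prop := forall us vs : seq V, R us vs = R vs us.

Definition first_bianchi R : Prop := forall x1 x2 x3 y : V,
  - R [:: x2; x3] [:: x1; y] + R [:: x1; x3] [:: x2; y]
  - R [:: x1; x2] [:: x3; y] = 0.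

(* dmul and dinner restrict on decomposable double forms to the defining
   formulas. *)
Lemma dmul_tens (a1 a2 a3 a4 : form V) xs ys :
  dmul (tens a1 a2) (tens a3 a4) xs ys = tens (wedge a1 a3) (wedge a2 a4) xs ys.
Proof.
rewrite /dmul /tens /wedge mulr_suml; apply: eq_bigr => s _.
by rewrite mulr_sumr; apply: eq_bigr => t _; rewrite [RHS]mulrACA; congr (_ * _);
  rewrite mulrACA.
Qed.

Lemma dinner_tens n (e : n.-tuple V) (a1 a2 a3 a4 : form V) :
  dinner e (tens a1 a2) (tens a3 a4) = finner e a1 a3 * finner e a2 a4.
Proof.
rewrite /dinner /tens /finner mulr_suml; apply: eq_bigr => s _.
by rewrite mulr_sumr; apply: eq_bigr => t _; rewrite mulrACA.
Qed.

Lemma is_dform_contr n (e : n.-tuple V) p q omega :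
  is_dform p.+1 q.+1 omega -> is_dform p q (dcontr e omega).
Proof.
case=> Hl Hr; split=> [ys|xs]; split.
- by move=> xs szx; apply: big1 => v _; have [-> //] := Hl (v :: ys).
- move=> s1 s2 a u w; rewrite /dcontr mulr_sumr -big_split /=.
  by apply: eq_bigr => v _; have [_ lin _] := Hl (v :: ys); apply: (lin (v :: s1)).
- move=> xs nu; apply: big1 => v _; have [_ _ -> //] := Hl (v :: ys).
  by rewrite cons_uniq (negPf nu) andbF.
- by move=> ys szy; apply: big1 => v _; have [-> //] := Hr (v :: xs).
- move=> s1 s2 a u w; rewrite /dcontr mulr_sumr -big_split /=.
  by apply: eq_bigr => v _; have [_ lin _] := Hr (v :: xs); apply: (lin (v :: s1)).
- move=> ys nu; apply: big1 => v _; have [_ _ -> //] := Hr (v :: xs).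
  by rewrite cons_uniq (negPf nu) andbF.
Qed.

End DoubleForms.

Arguments dunit {K V}.

(* Main.v *)
(** For [n = 2k+1], the form [A = R^k] has degree [n - 1] in each argument, so it
    is a combination of double forms [vol(-, e_u) vol(-, e_v)].  Contracting such
    a form [j] times gives [j!] times the generalized Kronecker delta
    [det (x_i == y_j)] of the lists [xs ++ [u]] and [ys ++ [v]].  Expanding these
    determinants of size 3, 2, 1 against [R], [c R], [c^2 R / 2], with
    [r = c R] and [t = c^2 R], the three terms become the coefficient-wise sums of
    [delta_uv t / 2 - r(v,u)], [delta_uv t - r(v,u)] and [delta_uv t / 2], whose
    alternating sum vanishes. *)

Require Import Defs.
From mathcomp Require Import all_boot all_order all_algebra all_fingroup.
From mathcomp Require Import reals.
From mathcomp Require Import ring lra zify.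

Set Implicit Arguments.
Unset Strict Implicit.
Unset Printing Implicit Defensive.

Import Order.TTheory GRing.Theory Num.Theory.
Local Open Scope ring_scope.

(** * Skew-symmetric functions on lists *)

(** Adjacent transpositions generate all permutations and fit the recursion on lists used for masks
    and contractions; no degree has to be tracked. *)
Definition skewsym (L : zmodType) (T : Type) (f : seq T -> L) : Prop :=
  forall (s1 s2 : seq T) (x y : T),
    f (s1 ++ x :: y :: s2) = - f (s1 ++ y :: x :: s2).

Definition dskewsym (K : realType) (V : vectType K) (omega : dform V) : Prop :=
  (forall ys, skewsym (fun xs => omega xs ys)) /\ (forall xs, skewsym (omega xs)).

(** A product of two skew functions has this property, so its arguments can be reordered without
    computing the sign of a permutation. *)
Definition swap_invariant (L T : Type) (f : seq T -> L) : Prop :=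
  forall (s1 s2 : seq T) (x y : T),
    f (s1 ++ x :: y :: s2) = f (s1 ++ y :: x :: s2).

Lemma skewsym_cons (L : zmodType) (T : Type) (f : seq T -> L) (z : T) :
  skewsym f -> skewsym (fun xs => f (z :: xs)).
Proof. by move=> fS s1 s2 x y; apply: (fS (z :: s1)). Qed.

Lemma skewsym_rcons (L : zmodType) (T : Type) (f : seq T -> L) (z : T) :
  skewsym f -> skewsym (fun xs => f (rcons xs z)).
Proof. by move=> fS s1 s2 x y; rewrite !rcons_cat; apply: fS. Qed.

Lemma skewsym_map (L : zmodType) (T U : Type) (h : U -> T) (f : seq T -> L) :
  skewsym f -> skewsym (fun xs => f (map h xs)).
Proof. by move=> fS s1 s2 x y; rewrite !map_cat; apply: fS. Qed.

Lemma skewsym_sign (L : pzRingType) (T : Type) (f : seq T -> L) :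
  skewsym f -> skewsym (fun xs => (-1) ^+ size xs * f xs).
Proof. by move=> fS s1 s2 x y; rewrite !size_cat fS mulrN. Qed.

Lemma skewsymM (L : pzRingType) (T : Type) (f g : seq T -> L) :
  skewsym f -> skewsym g -> swap_invariant (fun xs => f xs * g xs).
Proof. by move=> fS gS s1 s2 x y; rewrite fS gS mulrNN. Qed.

(** Adjacent swaps bring the head of [xs] to the front of [ys]; the induction hypothesis then
    applies to [f] with this head fixed. *)
Lemma swap_invariant_perm (L : Type) (T : eqType) (f : seq T -> L)
    (xs ys : seq T) :
  swap_invariant f -> perm_eq xs ys -> f xs = f ys.
Proof.
elim: xs ys f => [|x xs IH] ys f fI; first by rewrite perm_sym => /perm_nilP ->.
have front s1 s2 (h : seq T -> L) :
    swap_invariant h -> h (s1 ++ x :: s2) = h (x :: s1 ++ s2).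
  elim: s1 h => [|z s1 IHs] h hI //=.
  rewrite (IHs (fun l => h (z :: l))) => [|s s' a b]; last exact: (hI (z :: s)).
  exact: (hI [::]).
move=> pxy; have x_ys: x \in ys by rewrite -(perm_mem pxy) mem_head.
case/splitPr: x_ys pxy => s1 s2 pxy; rewrite front //.
apply: (IH _ (fun l => f (x :: l))) => [s s' a b|]; first exact: (fI (x :: s)).
by rewrite -(perm_cons x) (permPl pxy) perm_sym -cat1s perm_catCA.
Qed.

(* [f ^+ 2] is permutation invariant, which reduces a repetition to the head. *)
Lemma skewsym_nonuniq (K : numDomainType) (T : eqType) (f : seq T -> K)
    (xs : seq T) :
  skewsym f -> ~~ uniq xs -> f xs = 0.
Proof.
move=> fS; elim: xs f fS => [|x xs IH] f fS //=.
rewrite negb_and negbK => /orP[x_xs|nu]; last exact: (IH _ (skewsym_cons x fS)).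
have pxs: perm_eq (x :: xs) (x :: x :: rem x xs).
  by rewrite perm_cons perm_to_rem.
have := swap_invariant_perm (skewsymM fS fS) pxs; rewrite /=.
(* Swapping the two equal heads makes the value its own opposite, hence 0 since 2 is nonzero in
   [K]. *)
have /eqP := fS [::] (rem x xs) x x.
rewrite -addr_eq0 -mulr2n mulrn_eq0 /= => /eqP ->.
by rewrite mulr0 => /eqP; rewrite mulf_eq0 orbb => /eqP.
Qed.

(** * Skew-symmetry of products, powers and contractions *)

Lemma big_bits_cons (L : nmodType) (m : nat) (F : bitseq -> L) :
  \sum_(s : m.+1.-tuple bool) F s =
  \sum_(s : m.-tuple bool) (F (true :: s) + F (false :: s)).
Proof.
have hK : cancel (fun p : bool * m.-tuple bool => cons_tuple p.1 p.2)
                 (fun s => (thead s, [tuple of behead s])).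
  by case=> b s; congr pair; apply: val_inj.
have hK' : cancel (fun s => (thead s, [tuple of behead s]))
                (fun p : bool * m.-tuple bool => cons_tuple p.1 p.2).
  by move=> s; case/tupleP: s => b s; apply: val_inj.
rewrite (reindex (fun p : bool * m.-tuple bool => cons_tuple p.1 p.2)) /=; last first.
  by apply: onW_bij; exists (fun s => (thead s, [tuple of behead s])).
rewrite -(pair_bigA _ (fun b (s : m.-tuple bool) => F (b :: s))) /=.
by rewrite big_bool -big_split.
Qed.

(** The entry [x] goes either to [a] or to [b]. In the second case it crosses every entry given to
    [a]; the resulting sign depends only on the length of the argument of [a] and is absorbed into
    that factor. *)
Lemma wedge_cons (K : realType) (V : vectType K) (a b : Defs.form V) x xs :
  wedge a b (x :: xs) =
  wedge (fun l => a (x :: l)) b xs +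
  wedge (fun l => (-1) ^+ size l * a l) (fun l => b (x :: l)) xs.
Proof.
rewrite /wedge (@big_bits_cons _ (size xs) (fun s => shuffle_sign K s *
  (a (mask s (x :: xs)) * b (mask (map negb s) (x :: xs))))) -big_split /=.
apply: eq_bigr => s _.
congr (_ + _).
rewrite /shuffle_sign /= mul1n exprD size_mask ?size_tuple //.
by ring.
Qed.

Lemma eq_wedge (K : realType) (V : vectType K) (a a' b b' : Defs.form V) :
  a =1 a' -> b =1 b' -> wedge a b =1 wedge a' b'.
Proof.
by move=> Ha Hb xs; rewrite /wedge; apply: eq_bigr => s _; rewrite Ha Hb.
Qed.

Lemma wedgeNl (K : realType) (V : vectType K) (a b : Defs.form V) xs :
  wedge (fun l => - a l) b xs = - wedge a b xs.
Proof. by rewrite /wedge -sumrN; apply: eq_bigr => s _; rewrite mulNr mulrN. Qed.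

Lemma wedgeNr (K : realType) (V : vectType K) (a b : Defs.form V) xs :
  wedge a (fun l => - b l) xs = - wedge a b xs.
Proof. by rewrite /wedge -sumrN; apply: eq_bigr => s _; rewrite !mulrN. Qed.

(** The common prefix is peeled off with [wedge_cons], which replaces [a] and [b] by other skew
    functions. At the front, two expansions give four terms: [x] and [y] both in [a], both in [b],
    or one in each. *)
Lemma skewsym_wedge (K : realType) (V : vectType K) (a b : Defs.form V) :
  skewsym a -> skewsym b -> skewsym (wedge a b).
Proof.
move=> aS bS s1 s2 x y; elim: s1 a b aS bS => [|z s1 IH] a b aS bS /=; last first.
  rewrite !wedge_cons opprD; congr (_ + _); apply: IH => //.
  - exact: skewsym_cons.
  - exact: skewsym_sign.
  - exact: skewsym_cons.
rewrite !wedge_cons.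
rewrite (@eq_wedge _ _ _ (fun l => - a (y :: x :: l)) _ b) //; last first.
  by move=> l; apply: (aS [::]).
(* When both entries go to [b], the sign twist on [a] occurs twice and cancels. *)
rewrite (@eq_wedge _ _ (fun l => (-1) ^+ size l * ((-1) ^+ size l * a l)) a
   _ (fun l => - b (y :: x :: l))) //; last 2 first.
- by move=> l; rewrite mulrA -expr2 sqrr_sign mul1r.
- by move=> l; apply: (bS [::]).
rewrite [in RHS](@eq_wedge _ _ (fun l => (-1) ^+ size l * ((-1) ^+ size l * a l)) a
   _ (fun l => b (y :: x :: l))) //; last first.
  by move=> l; rewrite mulrA -expr2 sqrr_sign mul1r.
(* The two mixed terms differ by the extra entry counted in the sign, so exchanging [x] and [y]
   exchanges them up to a minus. *)
have E z : (fun l : seq V => (-1) ^+ size (z :: l) * a (z :: l)) =1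
           (fun l => - ((-1) ^+ size l * a (z :: l))).
  by move=> l; rewrite exprS -mulrA mulN1r.
rewrite (eq_wedge (E y) (fun=> erefl)) (eq_wedge (E x) (fun=> erefl)).
rewrite !wedgeNl wedgeNr; ring.
Qed.

(** With the second list fixed, the product is a signed sum of wedges in the first, which reduces
    its skew-symmetry to [skewsym_wedge]. *)
Lemma dmul_wedgel (K : realType) (V : vectType K) (omega eta : dform V) xs ys :
  dmul omega eta xs ys =
  \sum_(t : (size ys).-tuple bool) shuffle_sign K t *
    wedge (omega^~ (mask t ys)) (eta^~ (mask (map negb t) ys)) xs.
Proof.
rewrite /dmul exchange_big; apply: eq_bigr => t _; rewrite /wedge mulr_sumr.
by apply: eq_bigr => s _; ring.
Qed.

Lemma dmul_wedger (K : realType) (V : vectType K) (omega eta : dform V) xs ys :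
  dmul omega eta xs ys =
  \sum_(s : (size xs).-tuple bool) shuffle_sign K s *
    wedge (omega (mask s xs)) (eta (mask (map negb s) xs)) ys.
Proof.
rewrite /dmul; apply: eq_bigr => s _; rewrite /wedge mulr_sumr.
by apply: eq_bigr => t _; ring.
Qed.

Lemma dskewsym_mul (K : realType) (V : vectType K) (omega eta : dform V) :
  dskewsym omega -> dskewsym eta -> dskewsym (dmul omega eta).
Proof.
move=> [ol or] [el er]; split=> [ys|xs] s1 s2 x y.
- rewrite !dmul_wedgel -sumrN; apply: eq_bigr => t _; rewrite -mulrN.
  by congr (_ * _); apply: skewsym_wedge.
- rewrite !dmul_wedger -sumrN; apply: eq_bigr => t _; rewrite -mulrN.
  by congr (_ * _); apply: skewsym_wedge.
Qed.

Lemma dskewsym_unit (K : realType) (V : vectType K) : dskewsym (@dunit K V).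
Proof.
by split=> [ys|xs] [|z s1] s2 x y; rewrite /dunit /= ?andbF oppr0.
Qed.

Lemma dskewsym_exp (K : realType) (V : vectType K) (omega : dform V) k :
  dskewsym omega -> dskewsym (dexp omega k).
Proof.
move=> oS; case: k => [|k]; first exact: dskewsym_unit.
by elim: k => [|k IH] //; apply: dskewsym_mul.
Qed.

Lemma dskewsym_contr (K : realType) (V : vectType K) n (e : n.-tuple V)
    (omega : dform V) :
  dskewsym omega -> dskewsym (dcontr e omega).
Proof.
move=> [ol or]; split=> [ys|xs] s1 s2 x y; rewrite -sumrN.
- by apply: eq_bigr => v _; apply: (ol (v :: ys) (v :: s1)).
- by apply: eq_bigr => v _; apply: (or (v :: xs) (v :: s1)).
Qed.

Lemma dskewsym_iter_contr (K : realType) (V : vectType K) n (e : n.-tuple V)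
    j (omega : dform V) :
  dskewsym omega -> dskewsym (iter j (dcontr e) omega).
Proof. by move=> oS; elim: j => //= j; apply: dskewsym_contr. Qed.

Lemma dskewsym_scale (K : realType) (V : vectType K) a (omega : dform V) :
  dskewsym omega -> dskewsym (dscale a omega).
Proof.
move=> [ol or]; split=> [ys|xs] s1 s2 x y; rewrite /dscale -mulrN.
- by congr (_ * _); apply: ol.
- by congr (_ * _); apply: or.
Qed.

Lemma is_dform_scale (K : realType) (V : vectType K) p q a (omega : dform V) :
  is_dform p q omega -> is_dform p q (dscale a omega).
Proof.
case=> Hl Hr; split=> [ys|xs]; split; rewrite /dscale.
- by move=> xs sz; have [-> //] := Hl ys; rewrite mulr0.
- by move=> s1 s2 c u v; have [_ -> _] := Hl ys; ring.
- by move=> xs nu; have [_ _ -> //] := Hl ys; rewrite mulr0.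
- by move=> ys sz; have [-> //] := Hr xs; rewrite mulr0.
- by move=> s1 s2 c u v; have [_ -> _] := Hr xs; ring.
- by move=> ys nu; have [_ _ -> //] := Hr xs; rewrite mulr0.
Qed.

(** Polarization: expand the vanishing value at [x + y] repeated in two adjacent slots. *)
Lemma skewsym_form (K : realType) (V : vectType K) p (a : Defs.form V) :
  is_form p a -> skewsym a.
Proof.
case=> _ lin alt s1 s2 x y.
have add u v l1 l2 : a (l1 ++ (u + v) :: l2) = a (l1 ++ u :: l2) + a (l1 ++ v :: l2).
  by rewrite -{1}[u]scale1r lin mul1r.
have zero u : a (s1 ++ u :: u :: s2) = 0.
  by apply: alt; rewrite cat_uniq /= mem_head !andbF.
have add2 u : a (s1 ++ u :: (x + y) :: s2) =
    a (s1 ++ u :: x :: s2) + a (s1 ++ u :: y :: s2).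
  by have := add x y (rcons s1 u) s2; rewrite !cat_rcons.
have := zero (x + y); rewrite add !add2 !zero add0r addr0.
by move/eqP; rewrite addr_eq0 => /eqP.
Qed.

Lemma dskewsym_dform (K : realType) (V : vectType K) p q (omega : dform V) :
  is_dform p q omega -> dskewsym omega.
Proof. by case=> Hl Hr; split=> [ys|xs]; apply: skewsym_form. Qed.

(** * The generalized Kronecker delta *)

(* The generalized Kronecker delta, meaningful when both lists have size [m]:
   past the ends [onth] gives [None] on both sides, which compare equal. *)
Definition kdelta (K : comNzRingType) (T : eqType) (m : nat) (xs ys : seq T) : K :=
  \det (\matrix_(i < m, j < m) (onth xs i == onth ys j)%:R).

(** Since [w] is not in [xs], the first column is 1 followed by zeros, and the determinant is
    expanded along it. *)
Lemma kdelta_cons (K : comNzRingType) (T : eqType) m (w : T) (xs ys : seq T) :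
  w \notin xs -> kdelta K m.+1 (w :: xs) (w :: ys) = kdelta K m xs ys.
Proof.
move=> wN; rewrite /kdelta (expand_det_col _ ord0) big_ord_recl big1 => [|i _].
  rewrite !mxE eqxx mul1r addr0 /cofactor expr0 mul1r; congr (\det _).
  by apply/matrixP=> i j; rewrite !mxE.
by rewrite !mxE /= (negPf (onthPn wN i)) mul0r.
Qed.

Lemma kdelta_nonuniq (K : comNzRingType) (T : eqType) m (xs ys : seq T) :
  size xs = m -> ~~ uniq xs -> kdelta K m xs ys = 0.
Proof.
move=> <-; case: xs => [|x xs] //.
move/(uniqPn x) => [i [j [ij jsz eqij]]].
have im := ltn_trans ij jsz.
have neq : Ordinal im != Ordinal jsz by rewrite -val_eqE /= neq_ltn ij.
rewrite /kdelta; apply: determinant_alternate neq _ => l; rewrite !mxE.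
by rewrite !onthE (nth_map x) ?(nth_map x _ _ jsz) ?eqij.
Qed.

Lemma skewsym_kdelta (K : comNzRingType) (T : eqType) (ys : seq T) :
  skewsym (fun xs => kdelta K (size xs) xs ys).
Proof.
move=> s1 s2 x y; rewrite !size_cat /=; set m := (_ + _)%N.
have im : (size s1 < m)%N by rewrite /m; lia.
have jm : ((size s1).+1 < m)%N by rewrite /m; lia.
pose i := Ordinal im; pose j := Ordinal jm.
have neq : i != j by rewrite -val_eqE /= neq_ltn ltnSn.
rewrite /kdelta.
set A := (X in _ = - \det X).
have -> : (\matrix_(i0 < m, j0 < m)
    (onth (s1 ++ x :: y :: s2) i0 == onth ys j0)%:R) = xrow i j A.
  apply/matrixP => a b; rewrite !mxE !onth_cat; congr ((_ == _)%:R).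
  case: tpermP => [->|->|/eqP ai /eqP aj].
  - by rewrite /= ltnn subnn [X in if X then _ else _]ltnNge leqnSn /= subSnn.
  - by rewrite /= ltnn subnn [X in if X then _ else _]ltnNge leqnSn /= subSnn.
  (* Past both swapped positions the offset is at least 2; this form lets [onth] skip the two heads
     by computation. *)
  - case: ltnP => // sa; have -> : (a - size s1 = (a - size s1).-2.+2)%N.
      move: ai aj; rewrite -!val_eqE /=; lia.
    by [].
by rewrite xrowE det_mulmx det_perm odd_tperm neq mulN1r.
Qed.

Lemma onth_enum_ord (n : nat) (i : 'I_n) : onth (enum 'I_n) i = Some i.
Proof. by rewrite onthE (nth_map i) ?size_enum_ord // nth_ord_enum. Qed.

(** The product of two volume forms: transposing the second matrix and multiplying gives entries
    that sum [(x_i == l) * (y_j == l)] over [l], that is [x_i == y_j]. *)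
Lemma kdelta_enum (K : comNzRingType) (n : nat) (xs ys : seq 'I_n) :
  size xs = n -> size ys = n ->
  kdelta K n xs (enum 'I_n) * kdelta K n ys (enum 'I_n) = kdelta K n xs ys.
Proof.
move=> szx szy; rewrite /kdelta -[X in _ * X]det_tr -det_mulmx; congr (\det _).
apply/matrixP=> i j; rewrite !mxE.
have onth_ex (zs : seq 'I_n) (l : 'I_n) : size zs = n -> exists z, onth zs l = Some z.
  move=> sz; case E : (onth zs l) => [z|]; first by exists z.
  by have := onthTE zs l; rewrite E sz ltn_ord.
have [x xE] := onth_ex xs i szx; have [y yE] := onth_ex ys j szy.
rewrite (bigD1 x) //= big1 ?addr0 => [|l lx].
  by rewrite !mxE xE yE !onth_enum_ord eqxx mul1r eq_sym.
rewrite !mxE xE onth_enum_ord (_ : (Some x == Some l) = false) ?mul0r //.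
by apply/eqP => -[xl]; rewrite xl eqxx in lx.
Qed.

(** The trace of a Kronecker delta. An index [w] in [xs] repeats a row and contributes 0; each of
    the [n - size xs] others contributes the smaller delta. If [xs] has a repetition, both sides
    vanish. *)
Lemma kdelta_sum (K : comNzRingType) (n : nat) (xs ys : seq 'I_n) :
  \sum_(w : 'I_n) kdelta K (size xs).+1 (w :: xs) (w :: ys) =
  (n - size xs)%:R * kdelta K (size xs) xs ys.
Proof.
have [xU|xN] := boolP (uniq xs); last first.
  rewrite kdelta_nonuniq // mulr0 big1 // => w _; rewrite kdelta_nonuniq //=.
  by rewrite negb_and xN orbT.
rewrite (bigID (fun w => w \in xs)) /= big1 ?add0r => [|w wx]; last first.
  by rewrite kdelta_nonuniq //= wx.
rewrite (eq_bigr (fun=> kdelta K (size xs) xs ys)) => [|w wN]; last first.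
  exact: kdelta_cons.
rewrite sumr_const mulr_natl; congr (_ *+ _).
rewrite -(card_uniqP xU) -[RHS](congr1 (subn^~ _) (card_ord n)) /=.
rewrite -[X in (X - _)%N](cardC (mem xs)) addKn.
by apply: eq_card => w; rewrite !inE.
Qed.

(** * Expansion in volume forms and iterated contraction *)

(* [top] is the volume form: a skew [f] of degree [m] in dimension [m.+1] is
   determined by its values on the complements [co u] of single basis vectors. *)
Lemma skewsym_expand (K : numDomainType) (m : nat) (f : seq 'I_m.+1 -> K) :
  skewsym f ->
  let top us : K := kdelta K m.+1 us (enum 'I_m.+1) in
  let co u := rem u (enum 'I_m.+1) in
  forall xs, size xs = m ->
  f xs = \sum_u (top (rcons (co u) u) * f (co u)) * top (rcons xs u).
Proof.
move=> fS top co xs szx.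
have szE : size (enum 'I_m.+1) = m.+1 by rewrite size_enum_ord.
have szco u : size (co u) = m by rewrite size_rem ?mem_enum // szE.
have [xU|xN] := boolP (uniq xs); last first.
  rewrite skewsym_nonuniq // big1 // => u _.
  rewrite [X in _ * X]kdelta_nonuniq ?mulr0 ?size_rcons ?szx //.
  by rewrite rcons_uniq negb_and xN orbT.
(* The [m] distinct entries of [xs] miss an index among [m.+1]. *)
have [u uN] : exists u, u \notin xs.
  apply/existsP; rewrite -negb_forall; apply/negP=> /forallP allx.
  have := max_card (mem xs); have /eq_card -> : mem xs =i predT.
    by move=> u; rewrite inE; apply: allx.
  have := card_uniqP xU; rewrite szx; have /eq_card -> : mem xs =i predT.
    by move=> u; rewrite inE; apply: allx.
  by rewrite card_ord => /eqP; rewrite -{2}[m]addn0 -addn1 eqn_add2l.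
have pux : perm_eq (u :: xs) (enum 'I_m.+1).
  have uU : uniq (u :: xs) by rewrite /= uN.
  apply: uniq_perm => //; first exact: enum_uniq.
  apply: (uniq_min_size uU _ _).2 => [v _|]; first by rewrite mem_enum.
  by rewrite szE /= szx.
have px : perm_eq xs (co u).
  rewrite -(perm_cons u) (permPl pux); apply: perm_to_rem; exact: mem_enum.
(* Any [v] other than the missing index already occurs in [xs], so its volume factor vanishes. *)
rewrite (bigD1 u) //= big1 => [|v vu]; last first.
  rewrite [X in _ * X]kdelta_nonuniq ?mulr0 ?size_rcons ?szx //.
  rewrite rcons_uniq negb_and negbK; have := mem_enum 'I_m.+1 v.
  by rewrite -(perm_mem pux) !inE (negPf vu) /= => ->.
have topS : skewsym (fun us => kdelta K (size us) us (enum 'I_m.+1)).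
  exact: skewsym_kdelta.
(* Passing from [xs] to [co u] changes [top] and [f] by the same sign, so their product is
   unchanged; likewise the square of [top] is 1 on every ordering of the basis. *)
have := swap_invariant_perm (skewsymM (skewsym_rcons u topS) fS) px.
rewrite /= !size_rcons szx szco => Ef.
have pt : perm_eq (rcons xs u) (enum 'I_m.+1) by rewrite perm_rcons.
have := swap_invariant_perm (skewsymM topS topS) pt.
rewrite size_rcons szx szE => tt.
have enum1 : top (enum 'I_m.+1) = 1.
  rewrite /top /kdelta -[RHS](det1 K m.+1); congr (\det _); apply/matrixP=> i j.
  by rewrite !mxE (onth_enum_ord i) (onth_enum_ord j).
by rewrite addr0 /top -Ef mulrAC tt -/(top _) enum1 !mul1r.
Qed.

(** The coefficients are the same for all [j]. The indices [u] and [v] sit at the end of the lists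
    because contraction adds entries at the front. *)
Lemma iter_dcontr_expand (K : realType) (V : vectType K) (m : nat)
    (e : m.+1.-tuple V) (A : dform V) :
  dskewsym A ->
  exists a : 'I_m.+1 -> 'I_m.+1 -> K, forall j (xs ys : seq 'I_m.+1),
    (size xs + j = m)%N -> size ys = size xs ->
    iter j (dcontr e) A (map (tnth e) xs) (map (tnth e) ys) =
    j`!%:R *
    \sum_u \sum_v a u v * kdelta K (size xs).+1 (rcons xs u) (rcons ys v).
Proof.
move=> [Al Ar].
set top := fun us => kdelta K m.+1 us (enum 'I_m.+1).
set co := fun u => rem u (enum 'I_m.+1).
pose A' xs ys := A (map (tnth e) xs) (map (tnth e) ys).
have A'l ys : skewsym (A'^~ ys) by apply: skewsym_map (Al _).
have A'r xs : skewsym (A' xs) by apply: skewsym_map (Ar _).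
(* These are the coefficients of [skewsym_expand] applied in both arguments. *)
exists (fun u v => top (rcons (co u) u) * top (rcons (co v) v) * A' (co u) (co v)).
elim=> [|j IH] xs ys; last first.
  rewrite addnS -addSn => szx szy.
  rewrite iterS /dcontr big_tuple.
  under eq_bigr => w _.
    rewrite (IH (w :: xs) (w :: ys)) /= ?szy //; over.
  rewrite -mulr_sumr factS natrM [j.+1%:R * _]mulrC -!mulrA; congr (_ * _).
  rewrite mulr_sumr exchange_big; apply: eq_bigr => u _.
  rewrite mulr_sumr exchange_big; apply: eq_bigr => v _.
  rewrite -mulr_sumr mulrCA; congr (_ * _).
  (* The trace factor is [m.+1 - (size xs).+1], which equals [j.+1]: the factor taken out of the
     factorial above. *)
  have := kdelta_sum K (rcons xs u) (rcons ys v); rewrite size_rcons /= => ->.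
  by congr (_%:R * _); lia.
rewrite addn0 => szx szy; rewrite mul1r szx [LHS](skewsym_expand (A'l ys) szx).
apply: eq_bigr => u _.
rewrite [A' _ ys](skewsym_expand (A'r (co u)) (etrans szy szx)).
rewrite mulr_sumr mulr_suml; apply: eq_bigr => v _.
rewrite -(@kdelta_enum K m.+1 (rcons xs u)) ?size_rcons ?szy ?szx //.
rewrite /top; ring.
Qed.

(** * Sums over sublists and the inner product in degrees 0, 1 and 2 *)

Section MaskSums.
Variables (L : pzRingType) (T : Type).
Implicit Types (F : seq T -> L) (l : seq T).

Lemma big_mask_cons F x l :
  \sum_(s : (size l).+1.-tuple bool) F (mask s (x :: l)) =
  \sum_(s : (size l).-tuple bool) F (x :: mask s l) +
  \sum_(s : (size l).-tuple bool) F (mask s l).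
Proof. by rewrite (big_bits_cons _ (fun s => F (mask s (x :: l)))) big_split. Qed.

Lemma big_mask_nil F :
  \sum_(s : (size (@nil T)).-tuple bool) F (mask s [::]) = F [::].
Proof.
by rewrite (big_pred1 [tuple]) => [|s]; last by apply/esym/eqP/tuple0.
Qed.

Lemma big_mask0 F l : (forall xs, size xs != 0%N -> F xs = 0) ->
  \sum_(s : (size l).-tuple bool) F (mask s l) = F [::].
Proof.
move=> F0; elim: l => [|x l IH]; first exact: big_mask_nil.
by rewrite big_mask_cons IH big1 ?add0r // => s _; rewrite F0.
Qed.

Lemma big_mask1 F l : (forall xs, size xs != 1%N -> F xs = 0) ->
  \sum_(s : (size l).-tuple bool) F (mask s l) = \sum_(x <- l) F [:: x].
Proof.
move=> F1; elim: l => [|x l IH]; first by rewrite big_mask_nil big_nil F1.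
rewrite big_mask_cons IH big_cons; congr (_ + _).
by apply: (@big_mask0 (fun xs => F (x :: xs))) => xs sz; apply: F1.
Qed.

(** Masks select each pair of positions once, in increasing order, while the double sum meets it in
    both orders; the diagonal adds nothing. *)
Lemma big_mask2 F l : (forall xs, size xs != 2%N -> F xs = 0) ->
  (forall x, F [:: x; x] = 0) -> (forall x y, F [:: x; y] = F [:: y; x]) ->
  2 * \sum_(s : (size l).-tuple bool) F (mask s l) =
  \sum_(x <- l) \sum_(y <- l) F [:: x; y].
Proof.
move=> F2 Fd Fs; elim: l => [|x l IH]; first by rewrite big_mask_nil big_nil F2 ?mulr0.
rewrite big_mask_cons mulrDr IH !big_cons Fd add0r.
have -> : \sum_(y <- l) \sum_(z <- x :: l) F [:: y; z] =
    \sum_(y <- l) F [:: x; y] + \sum_(y <- l) \sum_(z <- l) F [:: y; z].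
  by rewrite -big_split; apply: eq_bigr => y _; rewrite big_cons Fs.
rewrite addrA; congr (_ + _).
rewrite (@big_mask1 (fun xs => F (x :: xs))) => [|xs sz]; last by apply: F2.
by rewrite mulr_natl mulr2n.
Qed.

End MaskSums.

Section InnerProduct.
Variables (K : realType) (V : vectType K) (n : nat) (e : n.-tuple V).
Implicit Types omega eta : dform V.

Lemma dinnerE omega eta : dinner e omega eta =
  \sum_(s : (size e).-tuple bool) \sum_(t : (size e).-tuple bool)
     omega (mask s e) (mask t e) * eta (mask s e) (mask t e).
Proof. by rewrite /dinner size_tuple. Qed.

Lemma dinner0 omega eta : is_dform 0 0 eta ->
  dinner e omega eta = omega [::] [::] * eta [::] [::].
Proof.
case=> Hl Hr; rewrite dinnerE.
under eq_bigr => s _.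
  rewrite (@big_mask0 _ _ (fun ys => omega (mask s e) ys * eta (mask s e) ys));
    last by move=> ys sz; have [-> //] := Hr (mask s e); rewrite mulr0.
  over.
rewrite (@big_mask0 _ _ (fun xs => omega xs [::] * eta xs [::])) // => xs sz.
by have [-> //] := Hl [::]; rewrite mulr0.
Qed.

Lemma dinner1 omega eta : is_dform 1 1 eta ->
  dinner e omega eta =
  \sum_i \sum_k omega [:: tnth e i] [:: tnth e k] * eta [:: tnth e i] [:: tnth e k].
Proof.
case=> Hl Hr; rewrite dinnerE.
under eq_bigr => s _.
  rewrite (@big_mask1 _ _ (fun ys => omega (mask s e) ys * eta (mask s e) ys));
    last by move=> ys sz; have [-> //] := Hr (mask s e); rewrite mulr0.
  over.
rewrite (@big_mask1 _ _ (fun xs => \sum_(y <- e) omega xs [:: y] * eta xs [:: y])).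
  by rewrite big_tuple; apply: eq_bigr => i _; rewrite big_tuple.
move=> xs sz; apply: big1 => y _.
by have [-> //] := Hl [:: y]; rewrite mulr0.
Qed.

(** The factor 4 is one 2 from [big_mask2] for each argument; the symmetry it asks for holds because
    [omega] and [eta] change sign together. *)
Lemma dinner2 omega eta : dskewsym omega -> is_dform 2 2 eta ->
  4 * dinner e omega eta =
  \sum_i \sum_j \sum_k \sum_l
    omega [:: tnth e i; tnth e j] [:: tnth e k; tnth e l] *
    eta [:: tnth e i; tnth e j] [:: tnth e k; tnth e l].
Proof.
move=> [ol or] eD; have [el er] := dskewsym_dform eD; case: eD => Hl Hr.
have four : 4 = 2 * 2 :> K by rewrite -natrM.
rewrite dinnerE four -mulrA mulr_sumr.
under eq_bigr => s _.
  rewrite (@big_mask2 _ _ (fun ys => omega (mask s e) ys * eta (mask s e) ys));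
    first over.
  - by move=> ys sz; have [-> //] := Hr (mask s e); rewrite mulr0.
  - by move=> x; have [_ _ -> //] := Hr (mask s e); rewrite ?mulr0 //= mem_head.
  - by move=> x y; apply: (skewsymM (or _) (er _) [::] [::]).
rewrite (@big_mask2 _ _ (fun xs => \sum_(x <- e) \sum_(y <- e)
   omega xs [:: x; y] * eta xs [:: x; y])).
- rewrite big_tuple; apply: eq_bigr => i _; rewrite big_tuple; apply: eq_bigr => j _.
  by rewrite big_tuple; apply: eq_bigr => k _; rewrite big_tuple.
- move=> xs sz; apply: big1 => x _; apply: big1 => y _.
  by have [-> //] := Hl [:: x; y]; rewrite mulr0.
- move=> z; apply: big1 => x _; apply: big1 => y _.
  by have [_ _ -> //] := Hl [:: x; y]; rewrite ?mulr0 //= mem_head.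
- move=> x y; apply: eq_bigr => z _; apply: eq_bigr => w _.
  exact: (skewsymM (ol _) (el _) [::] [::]).
Qed.

End InnerProduct.

(** * Small determinants contracted against a double form *)

Lemma kdelta1 (K : comNzRingType) (T : eqType) (u v : T) :
  kdelta K 1 [:: u] [:: v] = (u == v)%:R.
Proof. by rewrite /kdelta det_mx11 mxE. Qed.

Lemma kdelta2 (K : comNzRingType) (T : eqType) (i u k v : T) :
  kdelta K 2 [:: i; u] [:: k; v] =
  (i == k)%:R * (u == v)%:R - (i == v)%:R * (u == k)%:R.
Proof.
rewrite /kdelta (expand_det_row _ ord0) !big_ord_recl big_ord0 /cofactor.
rewrite !det_mx11 !mxE /=; ring.
Qed.

Lemma kdelta3 (K : comNzRingType) (T : eqType) (i j u k l v : T) :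
  kdelta K 3 [:: i; j; u] [:: k; l; v] =
  (i == k)%:R * ((j == l)%:R * (u == v)%:R - (j == v)%:R * (u == l)%:R) -
  (i == l)%:R * ((j == k)%:R * (u == v)%:R - (j == v)%:R * (u == k)%:R) +
  (i == v)%:R * ((j == k)%:R * (u == l)%:R - (j == l)%:R * (u == k)%:R).
Proof.
rewrite /kdelta (expand_det_row _ ord0) !big_ord_recl big_ord0 /cofactor.
rewrite !(expand_det_row _ ord0) !big_ord_recl !big_ord0 /cofactor.
rewrite !det_mx11 !mxE /=; ring.
Qed.

Lemma sum_kron (L : pzRingType) (I : finType) (x : I) (f : I -> L) :
  \sum_k (x == k)%:R * f k = f x.
Proof.
rewrite (bigD1 x) //= eqxx mul1r big1 ?addr0 // => k kx.
by rewrite eq_sym (negPf kx) mul0r.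
Qed.

Lemma sum_kron2 (L : comPzRingType) (I : finType) (x y : I) (f : I -> I -> L) :
  \sum_(p : I * I) (x == p.1)%:R * (y == p.2)%:R * f p.1 p.2 = f x y.
Proof.
rewrite -(pair_bigA _ (fun k l => (x == k)%:R * (y == l)%:R * f k l)) /=.
rewrite -[RHS](sum_kron x (f^~ y)); apply: eq_bigr => k _.
by rewrite -[X in _ = _ * X](sum_kron y) mulr_sumr; apply: eq_bigr => l _; rewrite mulrA.
Qed.

(** Of the six permutations, the two that match [u] with [v] each give the full trace, and each of
    the other four gives minus the single trace at [v] and [u], by skewness of [b]. *)
Lemma kdelta3_contract (K : comNzRingType) (I : finType)
    (b : I -> I -> I -> I -> K) (u v : I) :
  (forall i j k l, b i j k l = - b j i k l) ->
  (forall i j k l, b i j k l = - b i j l k) ->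
  \sum_i \sum_j \sum_k \sum_l
    kdelta K 3 [:: i; j; u] [:: k; l; v] * b i j k l =
  2 * (u == v)%:R * (\sum_i \sum_j b i j i j) - 4 * \sum_w b w v w u.
Proof.
move=> bl br.
have inner i j : \sum_k \sum_l kdelta K 3 [:: i; j; u] [:: k; l; v] * b i j k l =
    2 * (u == v)%:R * b i j i j - 2 * ((v == j)%:R * b i j i u)
    - 2 * ((v == i)%:R * b i j u j).
  rewrite pair_bigA /=.
  (* One summand per permutation; summing over [k] and [l] leaves three pairs of equal terms by
     [br]. *)
  transitivity (\sum_(p : I * I)
    ((i == p.1)%:R * (j == p.2)%:R * ((u == v)%:R * b i j p.1 p.2)
     - (i == p.1)%:R * (u == p.2)%:R * ((v == j)%:R * b i j p.1 p.2)
     - (j == p.1)%:R * (i == p.2)%:R * ((u == v)%:R * b i j p.1 p.2)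
     + (u == p.1)%:R * (i == p.2)%:R * ((v == j)%:R * b i j p.1 p.2)
     + (j == p.1)%:R * (u == p.2)%:R * ((v == i)%:R * b i j p.1 p.2)
     - (u == p.1)%:R * (j == p.2)%:R * ((v == i)%:R * b i j p.1 p.2))).
    by apply: eq_bigr => p _; rewrite kdelta3 (eq_sym v j) (eq_sym v i); ring.
  rewrite !(big_split, sumrN) /=.
  rewrite (sum_kron2 i j (fun k l => (u == v)%:R * b i j k l)).
  rewrite (sum_kron2 i u (fun k l => (v == j)%:R * b i j k l)).
  rewrite (sum_kron2 j i (fun k l => (u == v)%:R * b i j k l)).
  rewrite (sum_kron2 u i (fun k l => (v == j)%:R * b i j k l)).
  rewrite (sum_kron2 j u (fun k l => (v == i)%:R * b i j k l)).
  rewrite (sum_kron2 u j (fun k l => (v == i)%:R * b i j k l)).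
  by rewrite (br i j j i) (br i j u i) (br i j j u); ring.
under eq_bigr => i _ do (under eq_bigr => j _ do rewrite inner).
under eq_bigr => i _ do rewrite !(big_split, sumrN) /= -!mulr_sumr (sum_kron v (fun j => b i j i u)).
rewrite !(big_split, sumrN) /= -!mulr_sumr (sum_kron v (fun i => \sum_j b i j u j)).
have -> : \sum_j b v j u j = \sum_w b w v w u.
  by apply: eq_bigr => w _; rewrite bl br opprK.
ring.
Qed.

Lemma kdelta2_contract (K : comNzRingType) (I : finType) (r : I -> I -> K) (u v : I) :
  \sum_i \sum_k kdelta K 2 [:: i; u] [:: k; v] * r i k =
  (u == v)%:R * (\sum_i r i i) - r v u.
Proof.
transitivity (\sum_i \sum_k ((i == k)%:R * ((u == v)%:R * r i k)
                             - (u == k)%:R * ((v == i)%:R * r i k))).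
  apply: eq_bigr => i _; apply: eq_bigr => k _.
  by rewrite kdelta2 (eq_sym v i); ring.
under eq_bigr => i _ do rewrite big_split sumrN /= (sum_kron i (fun k => (u == v)%:R * r i k))
  (sum_kron u (fun k => (v == i)%:R * r i k)).
by rewrite big_split sumrN /= -mulr_sumr (sum_kron v (fun i => r i u)).
Qed.

(** * The alternating sum of inner products *)

(** Keeping [A] separate from [B] lets one identity serve both [A = R^k] and, in dimension 3,
    [A = R]. *)
Lemma contraction_identity (K : realType) (V : vectType K) (n : nat)
    (e : n.-tuple V) (A B : dform V) :
  (3 <= n)%N -> dskewsym A -> is_dform 2 2 B ->
  dinner e (dscale ((n - 3)`!%:R)^-1 (iter (n - 3) (dcontr e) A)) B
  - dinner e (dscale ((n - 2)`!%:R)^-1 (iter (n - 2) (dcontr e) A))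
      (dcontr e B)
  + dinner e (dscale ((n - 1)`!%:R)^-1 (iter (n - 1) (dcontr e) A))
      (dscale 2^-1 (iter 2 (dcontr e) B))
  = 0.
Proof.
case: n e => // m e; rewrite ltnS => m2 AS BD; rewrite !subSS subn0.
have BD1 : is_dform 1 1 (dcontr e B) by exact: is_dform_contr.
have BD0 : is_dform 0 0 (iter 2 (dcontr e) B) by do 2! apply: is_dform_contr.
have [a aE] := iter_dcontr_expand e AS.
(* The normalization cancels the [j!] produced by [j] contractions, so all three terms share the
   coefficients [a u v]. *)
have scaled j (xs ys : seq 'I_m.+1) : (size xs + j = m)%N -> size ys = size xs ->
    dscale (j`!%:R)^-1 (iter j (dcontr e) A) (map (tnth e) xs) (map (tnth e) ys) =
    \sum_u \sum_v a u v * kdelta K (size xs).+1 (rcons xs u) (rcons ys v).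
  move=> szx szy; rewrite /dscale aE // mulKf // pnatr_eq0 -lt0n.
  exact: fact_gt0.
pose b i j k l := B [:: tnth e i; tnth e j] [:: tnth e k; tnth e l].
pose r i k := \sum_w b w i w k.
have [Bl Br] := dskewsym_dform BD.
have bl i j k l : b i j k l = - b j i k l by apply: (Bl _ [::]).
have br i j k l : b i j k l = - b i j l k by apply: (Br _ [::]).
have cE i k : dcontr e B [:: tnth e i] [:: tnth e k] = r i k.
  by rewrite /dcontr big_tuple.
have ccE : iter 2 (dcontr e) B [::] [::] = \sum_i r i i.
  by rewrite /= {1}/dcontr big_tuple; apply: eq_bigr => i _; apply: cE.
have BD0' := is_dform_scale 2^-1 BD0.
set t := \sum_i r i i in ccE *.
have tE : t = \sum_i \sum_j b i j i j by rewrite /t /r exchange_big.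
have E2 : 4 * dinner e (dscale ((m - 2)`!%:R)^-1 (iter (m - 2) (dcontr e) A)) B =
    \sum_u \sum_v a u v * (2 * (u == v)%:R * t - 4 * r v u).
  rewrite dinner2 //; last by apply/dskewsym_scale/dskewsym_iter_contr.
  transitivity (\sum_i \sum_j \sum_k \sum_l \sum_u \sum_v
      a u v * (kdelta K 3 [:: i; j; u] [:: k; l; v] * b i j k l)).
    apply: eq_bigr => i _; apply: eq_bigr => j _.
    apply: eq_bigr => k _; apply: eq_bigr => l _.
    rewrite (scaled _ [:: i; j] [:: k; l]) //=; last by lia.
    rewrite mulr_suml; apply: eq_bigr => u _.
    by rewrite mulr_suml; apply: eq_bigr => v _; rewrite mulrA.
  (* Move the sum over [u], then the one over [v], outside the four sums over basis indices. *)
  under eq_bigr => i _ do under eq_bigr => j _ do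
    (under eq_bigr => k _ do rewrite exchange_big; rewrite exchange_big).
  under eq_bigr => i _ do rewrite exchange_big.
  rewrite exchange_big; apply: eq_bigr => u _.
  under eq_bigr => i _ do under eq_bigr => j _ do
    (under eq_bigr => k _ do rewrite exchange_big; rewrite exchange_big).
  under eq_bigr => i _ do rewrite exchange_big.
  rewrite exchange_big; apply: eq_bigr => v _.
  rewrite tE /r -(kdelta3_contract u v bl br) mulr_sumr.
  apply: eq_bigr => i _; rewrite mulr_sumr; apply: eq_bigr => j _.
  by rewrite mulr_sumr; apply: eq_bigr => k _; rewrite mulr_sumr.
have E1 : dinner e (dscale ((m - 1)`!%:R)^-1 (iter (m - 1) (dcontr e) A))
      (dcontr e B) = \sum_u \sum_v a u v * ((u == v)%:R * t - r v u).
  rewrite dinner1 //.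
  transitivity (\sum_i \sum_k \sum_u \sum_v
      a u v * (kdelta K 2 [:: i; u] [:: k; v] * r i k)).
    apply: eq_bigr => i _; apply: eq_bigr => k _.
    rewrite cE (scaled _ [:: i] [:: k]) //=; last by lia.
    rewrite mulr_suml; apply: eq_bigr => u _.
    by rewrite mulr_suml; apply: eq_bigr => v _; rewrite mulrA.
  under eq_bigr => i _ do rewrite exchange_big.
  rewrite exchange_big; apply: eq_bigr => u _.
  under eq_bigr => i _ do rewrite exchange_big.
  rewrite exchange_big; apply: eq_bigr => v _.
  rewrite -(kdelta2_contract r u v) mulr_sumr.
  by apply: eq_bigr => i _; rewrite mulr_sumr.
have E0 : 2 * dinner e (dscale (m`!%:R)^-1 (iter m (dcontr e) A))
      (dscale 2^-1 (iter 2 (dcontr e) B)) =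
    \sum_u \sum_v a u v * ((u == v)%:R * t).
  rewrite dinner0 // (scaled _ [::] [::]) // [dscale 2^-1 _ _ _]/dscale ccE.
  rewrite [LHS](_ : _ = (\sum_u \sum_v a u v * kdelta K 1 [:: u] [:: v]) * t).
    rewrite mulr_suml; apply: eq_bigr => u _; rewrite mulr_suml.
    by apply: eq_bigr => v _; rewrite kdelta1 mulrA.
  by rewrite /=; field.
(* This is four times the claim: [E2] carries the factor 4, [E1] none and [E0] a factor 2. For each
   [u] and [v] the coefficients of [(u == v)%:R * t] are 2, -4, 2 and those of [r v u] are -4, 4,
   0. *)
have sum0 : \sum_u \sum_v a u v * (2 * (u == v)%:R * t - 4 * r v u)
    - 4 * (\sum_u \sum_v a u v * ((u == v)%:R * t - r v u))
    + 2 * (\sum_u \sum_v a u v * ((u == v)%:R * t)) = 0.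
  rewrite !mulr_sumr -sumrB -big_split big1 //= => u _.
  rewrite !mulr_sumr -sumrB -big_split big1 //= => v _.
  by ring.
move: sum0; rewrite -E2 -E1 -E0; lra.
Qed.

Theorem proposition3p7 (K : realType) (V : vectType K) (g : {dot V for idfun})
    (n k : nat) (n_odd : n = (2 * k + 1)%N) (n_ge3 : (3 <= n)%N)
    (dimV : \dim {:V} = n)
    (e : n.-tuple V) (e_basis : basis_of {:V} e) (e_on : orthonormal g e)
    (R : dform V) (R_dform : is_dform 2 2 R) (R_sym : dsymmetric R)
    (R_bianchi : first_bianchi R) :
  dinner e (dscale ((n - 3)`!%:R)^-1 (iter (n - 3) (dcontr e) (dexp R k))) R
  - dinner e (dscale ((n - 2)`!%:R)^-1 (iter (n - 2) (dcontr e) (dexp R k)))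
      (dcontr e R)
  + dinner e (dscale ((n - 1)`!%:R)^-1 (iter (n - 1) (dcontr e) (dexp R k)))
      (dscale 2^-1 (iter 2 (dcontr e) R))
  = 0
  /\ (n = 3%N ->
      dinner e R R - dinner e (dcontr e R) (dcontr e R)
      + 4^-1 * (iter 2 (dcontr e) R [::] [::]) ^+ 2 = 0).
Proof.
have RS := dskewsym_dform R_dform.
split; first exact/contraction_identity/R_dform/dskewsym_exp.
(* In dimension 3 the identity is taken with [A = R]. The factorials are 1, 1 and 2, and the last
   one joins the half on [c^2 R] to give the coefficient 1/4. *)
move=> n3; move: (contraction_identity e n_ge3 RS R_dform).
have scale1 omega : dinner e (dscale 1^-1 omega) =1 dinner e omega.
  move=> eta; rewrite /dinner; apply: eq_bigr => s _; apply: eq_bigr => t _.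
  by rewrite /dscale invr1 mul1r.
have -> : (n - 3 = 0)%N by rewrite n3.
have -> : (n - 2 = 1)%N by rewrite n3.
have -> : (n - 1 = 2)%N by rewrite n3.
rewrite !scale1 => <-; congr (_ + _).
have D0 : is_dform 0 0 (iter 2 (dcontr e) R) by do 2! apply: is_dform_contr.
rewrite (dinner0 e _ (is_dform_scale _ D0)) /dscale (_ : 2`!%:R = 2) //.
by field.
Qed.
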